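(* Let $C$ be a bivariate copula and let $\gamma=\gamma(C)\in[-1,1]$ be its Gini's gamma. Then Blomqvist's beta $\beta(C)$ satisfies $\ell(\gamma)\leqslant\beta(C)\leqslant h(\gamma)$, where $$\ell(\gamma)=\begin{cases}-1, & \text{if } -1\leqslant\gamma\leqslant-\frac12,\\ 1-2\sqrt{\frac23(1-\gamma)}, & \text{otherwise,}\end{cases}\qquad h(\gamma)=\begin{cases}1, & \text{if } \frac12\leqslant\gamma\leqslant1,\\ -1+2\sqrt{\frac23(1+\gamma)}, & \text{otherwise.}\end{cases}$$
   Context: A bivariate copula is a function $C:[0,1]^2\to[0,1]$ with $C(u,0)=C(0,v)=0$, $C(u,1)=u$, $C(1,v)=v$, that is 2-increasing. Blomqvist's beta: $\beta(C)=4C\left(\tfrac12,\tfrac12\right)-1$. Concordance function: for copulas $C_1,C_2$, $\mathcal{Q}(C_1,C_2)=4\int_{[0,1]^2}C_2(u,v)\,dC_1(u,v)-1$, where $dC_1$ denotes integration with respect to the probability measure on $[0,1]^2$ with distribution function $C_1$. Gini's gamma: $\gamma(C)=\mathcal{Q}(C,M)+\mathcal{Q}(C,W)$, where $M(u,v)=\min\{u,v\}$ and $W(u,v)=\max\{0,u+v-1\}$. *)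

(* Defs.v *)
From HB Require Import structures.
From mathcomp Require Import all_boot all_order all_algebra.
From mathcomp Require Import all_classical all_reals all_analysis.

Set Implicit Arguments.
Unset Strict Implicit.
Unset Printing Implicit Defensive.

Import Order.TTheory GRing.Theory Num.Theory.
Import numFieldNormedType.Exports.

Local Open Scope classical_set_scope.
Local Open Scope ring_scope.

(* Functions on [0,1]^2 are encoded as total functions R -> R -> R; every
   condition below, and every quantity derived from them, involves only their
   values on the unit square. *)
Record copula (R : realType) (C : R -> R -> R) : Prop := Copula {
  copula_range : forall u v : R, u \in `[0, 1] -> v \in `[0, 1] ->
    C u v \in `[0, 1];
  copula_u0 : forall u : R, u \in `[0, 1] -> C u 0 = 0;
  copula_0v : forall v : R, v \in `[0, 1] -> C 0 v = 0;
  copula_u1 : forall u : R, u \in `[0, 1] -> C u 1 = u;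
  copula_1v : forall v : R, v \in `[0, 1] -> C 1 v = v;
  copula_2increasing : forall u1 u2 v1 v2 : R,
    u1 \in `[0, 1] -> u2 \in `[0, 1] -> v1 \in `[0, 1] -> v2 \in `[0, 1] ->
    u1 <= u2 -> v1 <= v2 ->
    0 <= C u2 v2 - C u2 v1 - C u1 v2 + C u1 v1
}.

Definition unit_square (R : realType) : set (R * R) := `[0, 1] `*` `[0, 1].

(* When C is a copula, u = v = 1 shows that P is concentrated on [0,1]^2. *)
Definition has_cdf (R : realType) (C : R -> R -> R)
    (P : probability (R * R)%type R) : Prop :=
  forall u v : R, u \in `[0, 1] -> v \in `[0, 1] ->
    P (`[0, u] `*` `[0, v]) = (C u v)%:E.

(* For a copula C such a probability exists and is unique (extension of
   measures), so the Dirac mass below is never used in that case. *)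
Definition copula_measure (R : realType) (C : R -> R -> R) :
    probability (R * R)%type R :=
  xget (\d_((0, 0) : R * R) : probability (R * R)%type R)
    [set P | has_cdf C P].

Definition concordance (R : realType) (C1 C2 : R -> R -> R) : R :=
  4 * (\int[copula_measure C1]_(x in @unit_square R) C2 x.1 x.2) - 1.

Definition upper_copula (R : realType) (u v : R) : R := Num.min u v.

Definition lower_copula (R : realType) (u v : R) : R := Num.max 0 (u + v - 1).

Definition gini_gamma (R : realType) (C : R -> R -> R) : R :=
  concordance C (@upper_copula R) + concordance C (@lower_copula R).

Definition blomqvist_beta (R : realType) (C : R -> R -> R) : R :=
  4 * C (1 / 2) (1 / 2) - 1.

Definition beta_lower (R : realType) (g : R) : R :=
  if -1 <= g <= - (1 / 2) then -1 else 1 - 2 * Num.sqrt (2 / 3 * (1 - g)).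

Definition beta_upper (R : realType) (g : R) : R :=
  if 1 / 2 <= g <= 1 then 1 else -1 + 2 * Num.sqrt (2 / 3 * (1 + g)).

(* Main.v *)
(* Let (U, V) have distribution function C and put d = C(1/2, 1/2). Then
   gamma = 4 E[M(U, V) + W(U, V)] - 2. Pointwise,
   M(x, y) + W(x, y) >= a(x) + a(y) + 3 d 1[x <= 1/2, y <= 1/2] for a piecewise
   linear function a, tight on the support of the smallest copula with value d at
   (1/2, 1/2); taking expectations gives gamma >= 6 d^2 - 1. Applied to
   (U, 1 - V), this yields gamma <= 1 - 6 (1/2 - d)^2. Both bounds are quadratic
   inequalities in beta = 4 d - 1.
   The probability with distribution function C is obtained by disintegration:
   u |-> C(u, q) has a Radon-Nikodym density k_q with respect to the uniform law,
   nondecreasing in q up to null sets, and for (u, w) uniform on the square,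
   (u, inf {q | w <= k_q(u)}), with q in a countable dense set, has the right law. *)
Require Import Defs.
From HB Require Import structures.
From mathcomp Require Import all_boot all_order all_algebra.
From mathcomp Require Import all_classical all_reals all_analysis.
From mathcomp Require Import measurable_realfun ring lra.

Set Implicit Arguments.
Unset Strict Implicit.
Unset Printing Implicit Defensive.

Import Order.TTheory GRing.Theory Num.Theory.
Import numFieldNormedType.Exports.

Local Open Scope classical_set_scope.
Local Open Scope ring_scope.

(** * Piecewise linear lower bound for M + W on the square *)

Section pointwise.
Context {R : realType}.
Implicit Types c d s x y : R.

Definition excess c x : R := Num.max 0 (x - c).

(** For c <= 1/2 this is the integral over t in [c, 1/2] of the indicator of t < x <= 1/2. *)
Definition half_excess c x : R := if x <= 1 / 2 then excess c x else 0.

(** This form reduces the mean of [half_excess] to means of [excess] and of one indicator. *)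
Lemma half_excessE c x : c <= 1 / 2 ->
  half_excess c x = excess c x - excess (1 / 2) x
                    - (1 / 2 - c) * (1 - (x <= 1 / 2)%R%:R).
Proof.
rewrite /half_excess /excess.
case: (leP x (1 / 2)) => xh; case: (leP 0 (x - c)) => xc;
  case: (leP 0 (x - 1 / 2)) => xh' ch /=; lra.
Qed.

(* Integrate over [t] in [0, 1] the bounds
   [1[x <= t, y <= t] >= Q - 1[t < x <= 1/2] - 1[t < y <= 1/2]] for
   [(1 - d)/2 <= t <= 1/2], where [Q] indicates [x, y <= 1/2], and [>= Q] for
   [1/2 <= t <= (1 + d)/2]. *)
Lemma min_ge_dual d x y : 0 <= d <= 1 / 2 ->
  (x - excess ((1 + d) / 2) x) + (y - excess ((1 + d) / 2) y) - (1 + d) / 2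
  + d * ((x <= 1 / 2)%R && (y <= 1 / 2)%R)%:R
  - half_excess ((1 - d) / 2) x - half_excess ((1 - d) / 2) y <= Num.min x y.
Proof.
rewrite /half_excess /excess => d01.
case: (leP x (1 / 2)) => xh; case: (leP y (1 / 2)) => yh /=;
case: (leP 0 (x - (1 + d) / 2)) => ?; case: (leP 0 (y - (1 + d) / 2)) => ?;
case: (leP 0 (x - (1 - d) / 2)) => ?; case: (leP 0 (y - (1 - d) / 2)) => ?;
case: (leP x y) => ?; lra.
Qed.

(* The same along the antidiagonal, for [|t - 1/2| <= d]. *)
Lemma lower_ge_dual d x y : 0 <= d <= 1 / 2 ->
  x + y - 1 + 2 * d * ((x <= 1 / 2)%R && (y <= 1 / 2)%R)%:R
  - half_excess (1 / 2 - d) x - half_excess (1 / 2 - d) y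
  <= Num.max 0 (x + y - 1).
Proof.
rewrite /half_excess /excess => d01.
case: (leP x (1 / 2)) => xh; case: (leP y (1 / 2)) => yh /=;
case: (leP 0 (x - (1 / 2 - d))) => ?; case: (leP 0 (y - (1 / 2 - d))) => ?;
case: (leP 0 (x + y - 1)) => ?; lra.
Qed.

(** The one-variable part of the sum of the two bounds above, with each [half_excess] expanded, the
    constant -(1 + d)/2 - 1 shared equally between x and y, and x written as [excess 0 x] so that
    all terms have means of one form. *)
Definition gini_dual d x : R :=
  2 * excess 0 x - excess ((1 + d) / 2) x - excess ((1 - d) / 2) x
  - excess (1 / 2 - d) x + 2 * excess (1 / 2) x
  - 3 / 2 * d * (x <= 1 / 2)%R%:R + (5 / 4 * d - 3 / 4).

Lemma gini_dual_le d x y : 0 <= d <= 1 / 2 -> 0 <= x -> 0 <= y ->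
  gini_dual d x + gini_dual d y + 3 * d * ((x <= 1 / 2)%R && (y <= 1 / 2)%R)%:R
  <= Num.min x y + Num.max 0 (x + y - 1).
Proof.
move=> d01 x0 y0.
have := min_ge_dual x y d01; have := lower_ge_dual x y d01.
have e0 z : 0 <= z -> excess 0 z = z by move=> z0; rewrite /excess subr0 max_r.
rewrite /gini_dual !e0// !half_excessE; [lra|lra..].
Qed.

End pointwise.

(** * Uniform random variables and their mean excess *)

Section uniform.
Context d (T : measurableType d) (R : realType) (P : probability T R).
Implicit Types (X Y f : T -> R) (t c : R).

(** The range condition holds everywhere, not just almost surely, so that pointwise inequalities on
    [0, 1] can be integrated directly. *)
Definition uniform_rv X : Prop := [/\ measurable_fun setT X,
  forall x, 0 <= X x <= 1 &
  forall t, 0 <= t <= 1 -> P [set x | X x <= t] = t%:E].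

Lemma measurable_le_level X t : measurable_fun setT X ->
  measurable [set x | X x <= t].
Proof.
move=> mX; rewrite -[X in measurable X]setTI.
have -> : [set x | X x <= t] = X @^-1` `]-oo, t].
  by apply/seteqP; split=> x /=; rewrite in_itv.
exact: mX.
Qed.

Lemma measurable_lt_level X t : measurable_fun setT X ->
  measurable [set x | X x < t].
Proof.
move=> mX; rewrite -[X in measurable X]setTI.
have -> : [set x | X x < t] = X @^-1` `]-oo, t[.
  by apply/seteqP; split=> x /=; rewrite in_itv.
exact: mX.
Qed.

Lemma measurable_excess c X :
  measurable_fun setT X -> measurable_fun setT (fun x => excess c (X x)).
Proof.
by move=> mX; apply: measurable_maxr => //; exact: measurable_funB.
Qed.

(** The tail is 1 - (c + r) until c + r reaches 1, and 0 beyond; the restricted-function form cuts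
    the tail integral down to [0, 1 - c]. *)
Lemma excess_tail c X r : uniform_rv X -> 0 <= c <= 1 -> 0 <= r ->
  P [set x | r < excess c (X x)] =
  ((fun r => (1 - c - r)%:E) \_ `[0, 1 - c]) r.
Proof.
move=> [mX X01 PX] /andP[c0 c1] r0; rewrite patchE.
have [|rc] := boolP (r \in _).
  rewrite inE /= in_itv /= => /andP[_ rc].
  have -> : [set x | r < excess c (X x)] = ~` [set x | X x <= c + r].
    apply/seteqP; split=> x /=; rewrite /excess lt_max.
      by move=> h h'; move: h; rewrite ltNge r0 /= => ?; lra.
    by move=> /negP; rewrite -ltNge => ?; apply/orP; right; lra.
  rewrite probability_setC; last exact: measurable_le_level.
  rewrite PX; last by lra.
  by rewrite -EFinB; congr (_%:E); lra.
rewrite (_ : [set _ | _] = set0) ?measure0//.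
apply/seteqP; split=> x //=; rewrite /excess lt_max ltNge r0 /= => h.
move: rc; rewrite notin_setE /= in_itv /= r0 /= => /negP; rewrite -ltNge => rc.
have := X01 x; lra.
Qed.

(** Layer-cake formula: the mean is the integral of the tail 1 - c - r over [0, 1 - c]. *)
Lemma expectation_excess c X : uniform_rv X -> 0 <= c <= 1 ->
  (\int[P]_x (excess c (X x))%:E = ((1 - c) ^+ 2 / 2)%:E)%E.
Proof.
move=> uX c01; have [mX X01 PX] := uX.
have mZ := measurable_excess c mX.
pose Z : {RV P >-> R} := HB.pack (fun x => excess c (X x))
  (isMeasurableFun.Build _ _ _ _ _ mZ).
have := @ge0_expectation_ccdf _ _ _ P Z.
rewrite unlock /= => ->; last by move=> x; rewrite /Z /= /excess le_max lexx.
under eq_integral => r.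
  rewrite inE /= in_itv /= andbT => r0.
  rewrite (_ : ccdf Z r = P [set x | r < excess c (X x)]); last first.
    rewrite /ccdf /distribution /pushforward /=; congr (P _).
    by apply/seteqP; split=> x /=; rewrite in_itv /= andbT.
  rewrite excess_tail//; over.
rewrite -integral_mkcondr setIidr; last first.
  by move=> r /=; rewrite !in_itv /= => /andP[->].
(* The fundamental theorem of calculus is applied on a nondegenerate interval, so c = 1 is treated
   apart. *)
have [c1|c1] := ltP c 1; last first.
  rewrite (_ : c = 1); last by lra.
  by rewrite subrr set_itv1 integral_set1 expr0n /= mul0r.
have cF : continuous (fun r : R => (1 - c) * r - r ^+ 2 / 2 : R).
  move=> r; apply: cvgB; first by apply: cvgM; [exact: cvg_cst|exact: cvg_id].
  apply: cvgM; last exact: cvg_cst.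
  exact: exprn_continuous.
have dF (r : R) : is_derive r (1 : R) (fun r : R => (1 - c) * r - r ^+ 2 / 2 : R)
    (1 - c - r).
  apply: is_derive_eq; rewrite /GRing.scale /=; lra.
rewrite (@continuous_FTC2 _ _ (fun r : R => (1 - c) * r - r ^+ 2 / 2)).
- rewrite -EFinB; congr (_%:E); lra.
- lra.
- apply: continuous_subspaceT => r.
  by apply: cvgB; [exact: cvg_cst|exact: cvg_id].
- split=> //.
  + exact/cvg_at_right_filter/cF.
  + exact/cvg_at_left_filter/cF.
- by move=> r _; rewrite derive1E; case: (dF r).
Qed.

End uniform.

(** * Means, and the two quadratic bounds on E[M + W] *)

Section mean.
Context d (T : measurableType d) (R : realType) (P : probability T R).
Implicit Types (X Y f g : T -> R) (m n k : R).

(** Bundling integrability with the value lets linearity be applied term by term without side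
    conditions. *)
Definition has_mean f m : Prop :=
  P.-integrable setT (EFin \o f) /\ \int[P]_x f x = m.

Lemma has_meanD f g m n : has_mean f m -> has_mean g n ->
  has_mean (fun x => f x + g x) (m + n).
Proof.
move=> [fi <-] [gi <-]; split; last by rewrite RintegralD.
exact: (integrableD measurableT fi gi).
Qed.

Lemma has_meanZ k f m : has_mean f m -> has_mean (fun x => k * f x) (k * m).
Proof.
move=> [fi <-]; split; last by rewrite RintegralZl.
exact: (integrableZl measurableT k fi).
Qed.

Lemma has_meanB f g m n : has_mean f m -> has_mean g n ->
  has_mean (fun x => f x - g x) (m - n).
Proof.
move=> [fi <-] [gi <-]; split; last by rewrite RintegralB.
exact: (integrableB measurableT fi gi).
Qed.

Lemma has_mean_cst k : has_mean (cst k) k.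
Proof.
split; first exact: finite_measure_integrable_cst.
by rewrite Rintegral_cst//= probability_setT mulr1.
Qed.

Lemma has_mean_bounded f k : measurable_fun setT f -> (forall x, `|f x| <= k) ->
  has_mean f (\int[P]_x f x).
Proof.
move=> mf fk; split=> //; apply: measurable_bounded_integrable => //.
  by rewrite ltey_eq fin_num_measure.
exists k; split; first exact: num_real.
by move=> y ky x _ /=; rewrite (le_trans (fk x))// ltW.
Qed.

Lemma has_mean_le f g m n : has_mean f m -> has_mean g n ->
  (forall x, f x <= g x) -> m <= n.
Proof. by move=> [fi <-] [gi <-] fg; exact: le_Rintegral. Qed.

Lemma has_mean_bool (b : T -> bool) :
  measurable [set x | b x] ->
  has_mean (fun x => (b x)%:R) (fine (P [set x | b x])).
Proof.
move=> mb; have -> : (fun x => (b x)%:R) = \1_[set x | b x] :> (T -> R).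
  by apply/funext => x; rewrite indicE; congr ((nat_of_bool _)%:R); apply/idP/idP; rewrite inE.
split; first by apply: integrable_indic => //; rewrite ltey_eq fin_num_measure.
by rewrite /Rintegral integral_indic// setIT.
Qed.

Lemma has_mean_excess c X : uniform_rv P X -> 0 <= c <= 1 ->
  has_mean (fun x => excess c (X x)) ((1 - c) ^+ 2 / 2).
Proof.
move=> uX c01; have [mX X01 _] := uX.
have := expectation_excess uX c01; rewrite /Rintegral.
have [//|fi _] := has_mean_bounded (measurable_excess c mX) (k := 1).
  move=> x; rewrite ger0_norm /excess ?le_max ?lexx// ge_max ler01 /=.
  by have := X01 x; lra.
by move=> E; split=> //; rewrite /Rintegral E.
Qed.

Lemma has_mean_gini_dual e X : uniform_rv P X -> 0 <= e <= 1 / 2 ->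
  has_mean (fun x => gini_dual e (X x)) (1 / 8 - 3 / 4 * e ^+ 2).
Proof.
move=> uX e01; have [mX X01 PX] := uX.
(* The value is expanded into the shape of [gini_dual], one mean per term. *)
rewrite (_ : 1 / 8 - _ = 2 * ((1 - 0) ^+ 2 / 2)
  - (1 - (1 + e) / 2) ^+ 2 / 2 - (1 - (1 - e) / 2) ^+ 2 / 2
  - (1 - (1 / 2 - e)) ^+ 2 / 2 + 2 * ((1 - 1 / 2) ^+ 2 / 2)
  - 3 / 2 * e * fine (P [set x | X x <= 1 / 2]) + (5 / 4 * e - 3 / 4)); last first.
  by rewrite PX /=; [field|lra].
have h c : 0 <= c <= 1 -> has_mean (fun x => excess c (X x)) ((1 - c) ^+ 2 / 2).
  exact: has_mean_excess.
apply: has_meanD; last exact: has_mean_cst.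
apply: has_meanB.
  apply: has_meanD; last by apply: has_meanZ; apply: h; lra.
  apply: has_meanB; last by apply: h; lra.
  apply: has_meanB; last by apply: h; lra.
  apply: has_meanB; last by apply: h; lra.
  by apply: has_meanZ; apply: h; lra.
apply: has_meanZ; apply: (has_mean_bool (b := fun x => X x <= 1 / 2)).
exact: measurable_le_level.
Qed.

Definition gini_kernel (x y : R) : R := Num.min x y + Num.max 0 (x + y - 1).

Lemma has_mean_gini_kernel X Y : uniform_rv P X -> uniform_rv P Y ->
  has_mean (fun x => gini_kernel (X x) (Y x))
    (\int[P]_x gini_kernel (X x) (Y x)).
Proof.
move=> [mX X01 _] [mY Y01 _]; apply: (has_mean_bounded (k := 2)).
  apply: measurable_funD; first exact: measurable_minr.
  by apply: measurable_maxr => //; do 2 ?apply: measurable_funD.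
move=> x; have := X01 x; have := Y01 x; rewrite /gini_kernel.
by case: (leP (X x) (Y x)) => ?; case: (leP 0 (X x + Y x - 1)) => ? ? ?;
  rewrite ger0_norm; lra.
Qed.

(** If e is the probability of the lower left quadrant, the dual bound with parameter d has mean 1/4
    - 3/2 d^2 + 3 d e, which is largest at d = e, the value chosen here. *)
Lemma gini_kernel_ge X Y : uniform_rv P X -> uniform_rv P Y ->
  1 / 4 + 3 / 2 * fine (P [set x | X x <= 1 / 2 /\ Y x <= 1 / 2]) ^+ 2
  <= \int[P]_x gini_kernel (X x) (Y x).
Proof.
move=> uX uY; have [mX X01 PX] := uX; have [mY Y01 PY] := uY.
have Q : [set x | X x <= 1 / 2 /\ Y x <= 1 / 2] =
    [set x | (X x <= 1 / 2) && (Y x <= 1 / 2)].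
  by apply/seteqP; split=> x /= /andP.
have mQ : measurable [set x | (X x <= 1 / 2) && (Y x <= 1 / 2)].
  by rewrite -Q; apply: measurableI; exact: measurable_le_level.
rewrite Q; set e := fine _.
have e01 : 0 <= e <= 1 / 2.
  rewrite fine_ge0//= -lee_fin fineK ?fin_num_measure// -PX; last by lra.
  by apply: le_measure; rewrite ?inE//; [exact: measurable_le_level|
    move=> x /= /andP[]].
have h : has_mean (fun x => gini_dual e (X x) + gini_dual e (Y x)
    + 3 * e * ((X x <= 1 / 2)%R && (Y x <= 1 / 2)%R)%:R)
    (1 / 8 - 3 / 4 * e ^+ 2 + (1 / 8 - 3 / 4 * e ^+ 2) + 3 * e * e).
  apply: has_meanD; last exact/has_meanZ/has_mean_bool.
  by apply: has_meanD; exact: has_mean_gini_dual.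
have /(_ _)/le_trans := has_mean_le h (has_mean_gini_kernel uX uY).
rewrite (_ : _ + 3 * e * e = 1 / 4 + 3 / 2 * e ^+ 2); last by field.
apply=> // x; apply: gini_dual_le => //; [have := X01 x|have := Y01 x]; lra.
Qed.

(** There is no atom at t: the event contains X <= t - e for every e > 0. *)
Lemma uniform_rv_lt X t : uniform_rv P X -> 0 <= t <= 1 ->
  P [set x | X x < t] = t%:E.
Proof.
move=> [mX X01 PX] t01; have mlt := measurable_lt_level t mX.
apply/eqP; rewrite eq_le; apply/andP; split.
  rewrite -PX//; apply: le_measure; rewrite ?inE//.
    exact: measurable_le_level.
  by move=> x /= /ltW.
apply/lee_subgt0Pr => e e0; rewrite -EFinB.
have [te|te] := leP 0 (t - e); last by rewrite (le_trans _ (measure_ge0 _ _))// lee_fin ltW.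
rewrite -(PX (t - e)); last by lra.
apply: le_measure; rewrite ?inE//; first exact: measurable_le_level.
by move=> x /= h; lra.
Qed.

Lemma uniform_rv_onem X : uniform_rv P X -> uniform_rv P (fun x => 1 - X x).
Proof.
move=> uX; have [mX X01 PX] := uX; split.
- exact: measurable_funB.
- by move=> x; have := X01 x; lra.
- move=> t t01.
  have -> : [set x | 1 - X x <= t] = ~` [set x | X x < 1 - t].
    by apply/seteqP; split=> x /=; [move=> ? ?|move=> /negP; rewrite -leNgt => ?]; lra.
  have mlt := measurable_lt_level (1 - t) mX.
  rewrite probability_setC// uniform_rv_lt//; last by lra.
  by rewrite -EFinB; congr (_%:E); lra.
Qed.

(* Reflecting [y] turns [gini_kernel] into [2 x - gini_kernel], which exchanges
   the two bounds. *)
Lemma gini_kernel_le X Y : uniform_rv P X -> uniform_rv P Y ->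
  \int[P]_x gini_kernel (X x) (Y x) <= 3 / 4 - 3 / 2 *
    (1 / 2 - fine (P [set x | X x <= 1 / 2 /\ Y x <= 1 / 2])) ^+ 2.
Proof.
move=> uX uY; have [mX X01 PX] := uX; have [mY Y01 PY] := uY.
have uY' := uniform_rv_onem uY.
have mQ : measurable [set x | X x <= 1 / 2 /\ Y x <= 1 / 2].
  by apply: measurableI; exact: measurable_le_level.
have mQ' : measurable [set x | X x <= 1 / 2 /\ 1 - Y x <= 1 / 2].
  by apply: measurableI; apply: measurable_le_level => //; exact: measurable_funB.
have hX : has_mean X (1 / 2).
  have := has_mean_excess (c := 0) uX.
  rewrite subr0 expr1n; have -> : (fun x => excess 0 (X x)) = X.
    by apply/funext => x; rewrite /excess subr0 max_r//; have /andP[] := X01 x.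
  by apply; lra.
have := has_mean_le (has_meanD (has_mean_gini_kernel uX uY)
  (has_mean_gini_kernel uX uY')) (has_meanZ 2 hX).
have := gini_kernel_ge uX uY'.
set e := fine (P [set x | X x <= 1 / 2 /\ 1 - Y x <= 1 / 2]).
set q := fine (P [set x | X x <= 1 / 2 /\ Y x <= 1 / 2]).
have q01 : 0 <= q <= 1 / 2.
  rewrite fine_ge0//= -lee_fin fineK ?fin_num_measure// -PX; last by lra.
  by apply: le_measure; rewrite ?inE//; [exact: measurable_le_level|move=> x []].
(* The quadrants Y <= 1/2 and 1 - Y <= 1/2 cover X <= 1/2 but may overlap, hence an inequality; it
   suffices, since then 0 <= 1/2 - q <= e. *)
have qe : 1 / 2 <= q + e.
  rewrite -lee_fin EFinD !fineK ?fin_num_measure// -PX; last by lra.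
  apply: le_trans (measureU2 _ mQ mQ').
  apply: le_measure; rewrite ?inE//; [exact: measurable_le_level|exact: measurableU|].
  by move=> x /= Xx; case: (leP (Y x) (1 / 2)) => ?; [left|right; split=> //; lra].
move=> ge le.
have : 1 / 4 + 3 / 2 * e ^+ 2 <= 2 * (1 / 2) - \int[P]_x gini_kernel (X x) (Y x).
  apply: (le_trans ge); rewrite lerBrDl; apply: le => x.
  have := X01 x; have := Y01 x; rewrite /gini_kernel.
  by case: (leP (X x) (Y x)) => ?; case: (leP (X x) (1 - Y x)) => ?;
    case: (leP 0 (X x + Y x - 1)) => ?; case: (leP 0 (X x + (1 - Y x) - 1)) => ? ? ?; lra.
nra.
Qed.

End mean.

(** * Comparison of Lebesgue-Stieltjes measures *)

Section stieltjes.
Context {R : realType}.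
Implicit Types (f : cumulative R R) (g : cumulativeBounded (0 : R) (1 : R)).

Lemma lebesgue_stieltjes_measure_oc f a b : a <= b ->
  lebesgue_stieltjes_measure f `]a, b] = (f b - f a)%:E.
Proof.
move=> ab; rewrite /lebesgue_stieltjes_measure /measure_extension.
rewrite measurable_mu_extE/=; last exact: is_ocitv.
by rewrite wlength_itv_bnd.
Qed.

(** Any cover by half-open intervals costs no more for f than for h, so the infima over covers
    compare. *)
Lemma le_lebesgue_stieltjes_measure f (h : cumulative R R) :
  (forall a b, a <= b -> f b - f a <= h b - h a) ->
  forall A, (lebesgue_stieltjes_measure f A <= lebesgue_stieltjes_measure h A)%E.
Proof.
move=> fh A; apply: le_ereal_inf_tmp => _ [F [mF AF] <-].
apply: (@le_trans _ _ (\sum_(0 <= k <oo) wlength f (F k))%E).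
  by apply: ereal_inf_lbound; exists F.
apply: lee_nneseries => [k _ _|k _]; first exact: wlength_ge0.
have [->|[[a b] /= ab ->]] := (ocitvP (F k)).1 (mF k).
  by rewrite !wlength0.
have ba := ltW ab.
rewrite /= !(wlength_itv_bnd _ _ _ ba).
by rewrite lee_fin fh.
Qed.

End stieltjes.

(** * Almost everywhere comparison from integrals *)

Section ae_le.
Context d (T : measurableType d) (R : realType).
Context (mu : {finite_measure set T -> \bar R}).

(** On the set where g < f, the positive function f - g has integral at most 0, so it vanishes
    almost everywhere there and the set is null. *)
Lemma integral_le_null (f g : T -> R) :
  mu.-integrable setT (EFin \o f) -> mu.-integrable setT (EFin \o g) ->
  (forall A, measurable A ->
    (\int[mu]_(x in A) (f x)%:E <= \int[mu]_(x in A) (g x)%:E)%E) ->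
  mu [set x | g x < f x] = 0.
Proof.
move=> fi gi fg; set A := [set x | g x < f x].
have /measurable_EFinP mf := measurable_int _ fi.
have /measurable_EFinP mg := measurable_int _ gi.
have mA : measurable A.
  by rewrite /A -[X in measurable X]setTI; exact: measurable_fun_ltr.
have mfg : measurable_fun A (fun x => (f x - g x)%:E).
  by apply/measurable_EFinP/measurable_funTS/measurable_funB.
have fiA : mu.-integrable A (EFin \o f) by exact: integrableS fi.
have giA : mu.-integrable A (EFin \o g) by exact: integrableS gi.
have [|N [mN N0 AN]] := (ae_eq_integral_abs mu mA mfg).1.
  apply/eqP; rewrite eq_le integral_ge0 ?andbT//.
  under eq_integral => x.
    rewrite inE => gf; rewrite gee0_abs; last by rewrite lee_fin subr_ge0 ltW.
    over.
  by rewrite integralB_EFin// sube_le0 fg.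
apply: (subset_measure0 mA mN _ N0) => x gfx; apply: AN => /(_ gfx) /eqP.
by rewrite eqe subr_eq0 gt_eqF.
Qed.
End ae_le.

(** * Densities of dominated Stieltjes measures *)

Section density.
Context {R : realType}.
Implicit Types (f : cumulative R R) (g : cumulativeBounded (0 : R) (1 : R)).

(** The measure of f is at most that of g on every set, hence absolutely continuous, and its
    Radon-Nikodym density exceeds 1 only on a null set. *)
Lemma stieltjes_density g f :
  (forall a b, a <= b -> f b - f a <= g b - g a) ->
  exists k : measurableTypeR R -> R, [/\ measurable_fun setT k,
    forall x, 0 <= k x <= 1 &
    forall A, measurable A -> lebesgue_stieltjes_measure f A =
      (\int[lebesgue_stieltjes_measure g]_(x in A) (k x)%:E)%E].
Proof.
move=> fg; set U := lebesgue_stieltjes_measure g.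
set nu := lebesgue_stieltjes_measure f.
have nuU A : (nu A <= U A)%E by exact: le_lebesgue_stieltjes_measure.
have nu_fin : fin_num_fun nu.
  move=> A mA; rewrite ge0_fin_numE//; apply: (le_lt_trans (nuU A)).
  by rewrite ltey_eq fin_num_measure.
pose nu' : {finite_measure set (measurableTypeR R) -> \bar R} :=
  HB.pack (nu : set (measurableTypeR R) -> \bar R) (Measure.on nu)
    (Measure_isFinite.Build _ _ _ nu nu_fin).
have dom : nu' `<< U.
  apply/null_content_dominatesP => A mA UA0; apply/eqP.
  by rewrite eq_le measure_ge0 andbT -UA0; exact: nuU.
have [k0 [k0_ge0 k0_fin k0_int k0E]] := radon_nikodym_sigma_finite dom.
have mk0 : measurable_fun setT (fine \o k0).
  by apply: measurableT_comp => //; exact: measurable_int k0_int.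
have k0f : k0 = EFin \o (fine \o k0) by apply/funext => x /=; rewrite fineK.
have null : U [set x | cst 1 x < (fine \o k0) x] = 0.
  apply: integral_le_null; first by rewrite -k0f.
    exact: finite_measure_integrable_cst.
  move=> A mA; rewrite /= integral_cst// mul1e.
  apply: le_trans (nuU A); rewrite -[nu A]/(nu' A) k0E ?inE//.
  by rewrite [in leRHS]k0f.
(* Truncation at 1 changes the density on a null set only and makes the bound hold everywhere. *)
exists (fun x => Num.min (fine (k0 x)) 1); split.
- exact: measurable_minr.
- by move=> x; rewrite le_min ge_min lexx orbT fine_ge0// ler01.
- move=> A mA; rewrite -[nu A]/(nu' A) k0E ?inE//.
  apply: ae_eq_integral => //.
  + by apply: measurable_funTS; exact: measurable_int k0_int.
  + by apply/measurable_EFinP/measurable_funTS/measurable_minr.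
  + exists [set x | cst 1 x < (fine \o k0) x]; split=> //.
      by rewrite -[X in measurable X]setTI; exact: measurable_fun_ltr.
    move=> x /=; apply: contra_notP => /negP; rewrite -leNgt => k1 _.
    by rewrite min_l// fineK.
Qed.

End density.

(** * Projection onto [0, 1] and a countable dense set *)

Section clamp.
Context {R : realType}.
Implicit Types x y : R.

(** It has two uses: extending functions from [0, 1] to the line, and serving as the distribution
    function of the uniform law. *)
Definition clamp x : R := Num.max 0 (Num.min x 1).

Lemma clamp_ge0 x : 0 <= clamp x.
Proof. by rewrite /clamp le_max lexx. Qed.

Lemma clamp_le1 x : clamp x <= 1.
Proof. by rewrite /clamp ge_max ler01 ge_min lexx orbT. Qed.

Lemma clamp_itv x : clamp x \in `[0, 1].
Proof. by rewrite in_itv /= clamp_ge0 clamp_le1. Qed.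

Lemma clamp_id x : 0 <= x <= 1 -> clamp x = x.
Proof. by rewrite /clamp => /andP[x0 x1]; rewrite min_l// max_r. Qed.

Lemma clamp_le0 x : x <= 0 -> clamp x = 0.
Proof.
by move=> x0; rewrite /clamp max_l// ge_min x0.
Qed.

Lemma clamp_ge1 x : 1 <= x -> clamp x = 1.
Proof. by move=> x1; rewrite /clamp min_r// max_r. Qed.

Lemma le_clamp x y : x <= y -> clamp x <= clamp y.
Proof.
rewrite /clamp; case: (leP x 1) => ?; case: (leP y 1) => ?;
  case: (leP 0 x) => ?; case: (leP 0 y) => ? ?; rewrite ?(max_r ler01); lra.
Qed.

Lemma clampB_le x y : x <= y -> clamp y - clamp x <= y - x.
Proof.
rewrite /clamp; case: (leP x 1) => ?; case: (leP y 1) => ?;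
  case: (leP 0 x) => ?; case: (leP 0 y) => ? ?; rewrite ?(max_r ler01); lra.
Qed.

Lemma measurable_clamp d (T : measurableType d) (f : T -> R) :
  measurable_fun setT f -> measurable_fun setT (clamp \o f).
Proof.
by move=> mf; apply: measurable_maxr => //; exact: measurable_minr.
Qed.

Lemma right_continuous_lip (f : R -> R) :
  (forall x y, x <= y -> f x <= f y <= f x + (y - x)) -> right_continuous f.
Proof.
move=> fl x; apply/cvgrPdist_le => e e0; near=> y.
have xy : x <= y by near: y; exact: nbhs_right_ge.
have ye : y < x + e by near: y; apply: nbhs_right_lt; rewrite ltrDl.
have /andP[h1 h2] := fl _ _ xy.
rewrite distrC ger0_norm ?subr_ge0// lerBlDl (le_trans h2)// lerD2l.
by rewrite lerBlDl ltW.
Unshelve. all: by end_near. Qed.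

Lemma uniform_cumulative :
  exists g : cumulativeBounded (0 : R) (1 : R), g = clamp :> (R -> R).
Proof.
have nd : nondecreasing clamp by move=> x y; exact: le_clamp.
have rc : right_continuous clamp.
  apply: right_continuous_lip => x y xy.
  by rewrite le_clamp//=; have := clampB_le xy; lra.
have cy : clamp @ +oo --> (1 : R).
  apply: cvg_near_cst; near=> x; apply: clamp_ge1.
  by near: x; exact: nbhs_pinfty_ge.
have cNy : clamp @ -oo --> (0 : R).
  apply: cvg_near_cst; near=> x; apply: clamp_le0.
  by near: x; exact: nbhs_ninfty_le.
pose g : cumulativeBounded (0 : R) (1 : R) := HB.pack clamp
  (isCumulative.Build R _ R clamp nd rc)
  (isCumulativeBounded.Build R 0 1 clamp cNy cy).
by exists g.
Unshelve. all: by end_near. Qed.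

(** An enumeration of the rationals, projected onto [0, 1]; integers that code no rational give
    0. *)
Definition clamped_rat n : R := clamp (ratr (odflt (0 : rat) (unpickle n))).

Lemma clamped_rat_dense x y : 0 <= x -> x < y -> y <= 1 ->
  exists n, x < clamped_rat n < y.
Proof.
move=> x0 xy y1; have [q] := rat_in_itvoo xy; rewrite in_itv /= => /andP[xq qy].
exists (pickle q); rewrite /clamped_rat pickleK /= clamp_id ?xq ?qy//.
by rewrite (le_trans x0) ?(ltW xq)// (le_trans (ltW qy)).
Qed.

End clamp.

(** * Extension of a copula to the plane *)

Section clamped_copula.
Context {R : realType} (C : R -> R -> R) (hC : copula C).
Implicit Types u v : R.

Definition clamped u v : R := C (clamp u) (clamp v).

Lemma clamped_2increasing u1 u2 v1 v2 : u1 <= u2 -> v1 <= v2 ->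
  0 <= clamped u2 v2 - clamped u2 v1 - clamped u1 v2 + clamped u1 v1.
Proof.
by move=> u12 v12; apply: (copula_2increasing hC); rewrite ?clamp_itv ?le_clamp.
Qed.

Lemma clamped_u0 u v : v <= 0 -> clamped u v = 0.
Proof.
by move=> v0; rewrite /clamped (clamp_le0 v0) (copula_u0 hC)// clamp_itv.
Qed.

Lemma clamped_0v u v : u <= 0 -> clamped u v = 0.
Proof.
by move=> u0; rewrite /clamped (clamp_le0 u0) (copula_0v hC)// clamp_itv.
Qed.

Lemma clamped_u1 u v : 1 <= v -> clamped u v = clamp u.
Proof.
by move=> v1; rewrite /clamped (clamp_ge1 v1) (copula_u1 hC)// clamp_itv.
Qed.

Lemma clamped_1v u v : 1 <= u -> clamped u v = clamp v.
Proof.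
by move=> u1; rewrite /clamped (clamp_ge1 u1) (copula_1v hC)// clamp_itv.
Qed.

(** The 2-increasing inequality between v and a level at most 0, where the extension vanishes. *)
Lemma clamped_le_u u1 u2 v : u1 <= u2 -> clamped u1 v <= clamped u2 v.
Proof.
move=> u12; have := @clamped_2increasing u1 u2 (Num.min v 0) v u12.
by rewrite ge_min lexx !(@clamped_u0 _ (Num.min v 0)) ?ge_min ?lexx ?orbT//; lra.
Qed.

(** The 2-increasing inequality between v and a level at least 1, where the extension is [clamp] of
    u. *)
Lemma clamped_lip_u u1 u2 v : u1 <= u2 ->
  clamped u2 v - clamped u1 v <= clamp u2 - clamp u1.
Proof.
move=> u12; have := @clamped_2increasing u1 u2 v (Num.max v 1) u12.
by rewrite le_max lexx !(@clamped_u1 _ (Num.max v 1)) ?le_max ?lexx ?orbT//; lra.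
Qed.

Lemma clamped_lip_v u v1 v2 : v1 <= v2 ->
  clamped u v2 - clamped u v1 <= v2 - v1.
Proof.
move=> v12; have := @clamped_2increasing u (Num.max u 1) v1 v2.
rewrite le_max lexx !(@clamped_1v (Num.max u 1)) ?le_max ?lexx ?orbT//.
by have := clampB_le v12; lra.
Qed.

Lemma slice_cumulative v :
  exists f : cumulative R R, f = clamped ^~ v :> (R -> R).
Proof.
have nd : nondecreasing (clamped ^~ v) by move=> x y; exact: clamped_le_u.
have rc : right_continuous (clamped ^~ v).
  apply: right_continuous_lip => x y xy; rewrite clamped_le_u//=.
  by have := clampB_le xy; have := clamped_lip_u v xy; lra.
pose f : cumulative R R := HB.pack (clamped ^~ v)
  (isCumulative.Build R _ R (clamped ^~ v) nd rc).
by exists f.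
Qed.

End clamped_copula.

(** * Mass of half-lines under measures dominated by the uniform law *)

Section densities.
Context {R : realType}.

(** The uniform law gives ]-1, 1] mass 1, so ]-oo, -1] is null for it and for every dominated
    measure; only the increment over ]-1, t] remains. *)
Lemma uniform_probability :
  exists g : cumulativeBounded (0 : R) (1 : R), g = clamp :> (R -> R) /\
  forall f : cumulative R R, (forall a b, a <= b -> f b - f a <= g b - g a) ->
    forall t : R, 0 <= t -> lebesgue_stieltjes_measure f `]-oo, t]%classic =
      (f t - f (-1))%:E.
Proof.
have [g gE] := @uniform_cumulative R; exists g; split=> // f fg t t0.
pose U : probability (measurableTypeR R) R := lebesgue_stieltjes_measure g.
have m1t : -1 <= t by lra.
pose L : set R := `]-oo, -1]%classic.
have low : U L = 0.
  pose I : set R := `]-1, 1]%classic.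
  have UI : U I = 1%E.
    rewrite [LHS]lebesgue_stieltjes_measure_oc; last by lra.
    by rewrite /= !gE clamp_ge1// clamp_le0 ?subr0//; lra.
  have : (U L <= U (~` I))%E.
    apply: le_measure; rewrite ?inE//; first exact: measurable_itv.
      by apply: measurableC; exact: measurable_itv.
    by move=> x; rewrite /L /I /= !in_itv /= => xL /andP[]; rewrite ltNge xL.
  rewrite probability_setC ?UI ?subee// => [h|]; last exact: measurable_itv.
  by apply/eqP; rewrite eq_le h measure_ge0.
have -> : (`]-oo, t]%classic : set R) = L `|` `]-1, t]%classic.
  apply/seteqP; split=> x; rewrite /L /= !in_itv /=.
    by move=> xt; case: (leP x (-1)) => ?; [left|right].
  by move=> [xL|/andP[_ //]]; apply: le_trans xL _.
rewrite measureU//; [|exact: measurable_itv..|]; last first.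
  by apply/seteqP; split=> x //= []; rewrite /L /= !in_itv /= => xL /andP[]; rewrite ltNge xL.
have fL : lebesgue_stieltjes_measure f L = 0.
  apply/eqP; rewrite eq_le measure_ge0 andbT -low.
  exact: le_lebesgue_stieltjes_measure.
exact: etrans (congr2 (fun a b => a + b)%E fL
  (lebesgue_stieltjes_measure_oc f m1t)) (add0e _).
Qed.

End densities.

(** * Measure of the region below a graph *)

Section product_sublevel.
Context d (T : measurableType d) {R : realType}.
Context (P : probability T R) (U : probability (measurableTypeR R) R).
Hypothesis U_cdf : forall t : R, 0 <= t <= 1 -> U `]-oo, t]%classic = t%:E.

Lemma measurable_product_sublevel (A : set T) (k : T -> R) :
  measurable A -> measurable_fun setT k ->
  measurable [set z : T * measurableTypeR R | A z.1 /\ z.2 <= k z.1].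
Proof.
move=> mA mk; apply: measurableI.
  rewrite -[X in measurable X]setTI; exact: measurable_fst.
rewrite -[X in measurable X]setTI.
apply: (@measurable_fun_ler _ _ R setT snd (k \o fst)) => //.
exact: measurableT_comp.
Qed.

(** Over x in A the section is ]-oo, k x], of [U]-measure k x; the other sections are empty. *)
Lemma product_sublevel (A : set T) (k : T -> R) :
  measurable A -> measurable_fun setT k -> (forall x, 0 <= k x <= 1) ->
  (P \x U)%E [set z | A z.1 /\ z.2 <= k z.1] = (\int[P]_(x in A) (k x)%:E)%E.
Proof.
move=> mA mk k01; rewrite /product_measure1 [RHS]integral_mkcond.
apply: eq_integral => x _ /=; rewrite patchE; case: ifPn => xA.
  rewrite -U_cdf//; congr (U _); apply/seteqP; split=> y; rewrite /xsection /= in_itv /=.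
    by rewrite inE => -[].
  by move=> yk; rewrite inE; split=> //; exact: set_mem.
rewrite (_ : xsection _ _ = set0) ?measure0//.
apply/seteqP; split=> y; rewrite /xsection /= ?inE// => -[Ax _].
by move: xA; rewrite notin_setE.
Qed.

End product_sublevel.

(** * Construction of the probability with distribution function C *)

Section copula_measure_existence.
Context {R : realType} (C : R -> R -> R) (hC : copula C).
Let T := measurableTypeR R.

(* [k v] is a version of the conditional distribution function
   [u |-> d/du C(u, v)], monotone in [v] up to null sets. *)
Lemma copula_densities : exists (U : probability T R) (k : R -> T -> R),
  [/\ forall t : R, 0 <= t <= 1 -> U `]-oo, t]%classic = t%:E,
      forall v, measurable_fun setT (k v),
      forall v x, 0 <= k v x <= 1,
      forall v (t : R), 0 <= t -> (\int[U]_(x in `]-oo, t]) (k v x)%:E)%E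
                                  = (clamped C t v)%:E &
      forall v w, v <= w -> U [set x | k w x < k v x] = 0].
Proof.
have [g [gE lower]] := @uniform_probability R.
have /choice[f fE] := slice_cumulative hC.
have fg v a b : a <= b -> f v b - f v a <= g b - g a.
  by move=> ab; rewrite !fE /= !gE clamped_lip_u.
have /choice[k kP] := fun v => stieltjes_density (fg v).
exists (lebesgue_stieltjes_measure g), k; split.
- move=> t /andP[t0 t1]; rewrite [LHS]lower//.
  by rewrite /= !gE (clamp_le0 (x := -1)) ?subr0 ?clamp_id ?t0//; lra.
- by move=> v; have [] := kP v.
- by move=> v x; have [] := kP v.
- move=> v t t0; have [_ _ <-] := kP v; last exact: measurable_itv.
  rewrite [LHS](lower _ (fg v))// !fE.
  by rewrite (clamped_0v hC (u := -1)) ?subr0//; lra.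
- move=> v w vw; have [mv v01 vE] := kP v; have [mw w01 wE] := kP w.
  have bi (h : T -> R) : measurable_fun setT h -> (forall x, 0 <= h x <= 1) ->
      (lebesgue_stieltjes_measure g).-integrable setT (EFin \o h).
    move=> mh h01; pose U : probability T R := lebesgue_stieltjes_measure g.
    have [|//] := @has_mean_bounded _ T R U h 1 mh.
    by move=> x; have /andP[h0 h1] := h01 x; rewrite ger0_norm.
  (* By 2-increasingness the slice at v has smaller increments than the slice at w, hence a smaller
     measure. *)
  apply: integral_le_null; [exact: bi|exact: bi|move=> A mA].
  rewrite -vE// -wE//; apply: le_lebesgue_stieltjes_measure => a b ab.
  by rewrite !fE; have := clamped_2increasing hC ab vw; lra.
Qed.


(** The event V <= v is squeezed, up to null sets, between the events w <= k_q(u) for q just below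
    and just above v; the Lipschitz property of C in its second variable closes the gap. *)
Lemma copula_has_cdf : exists P : probability (R * R)%type R, has_cdf C P.
Proof.
have [U [k [U_cdf mk k01 kint kmono]]] := copula_densities.
pose m : probability (T * T)%type R := (U \x U)%E.
pose q n : R := clamped_rat n.
have q01 n : 0 <= q n <= 1 by rewrite clamp_ge0 clamp_le1.
(* The default 1 bounds every level, so the infimum over n is that of the admissible levels, or 1 if
   there are none. *)
pose X n (z : T * T) : R := if z.2 <= k (q n) z.1 then q n else 1.
have X01 n z : 0 <= X n z <= 1.
  by rewrite /X; case: ifP => _; rewrite ?q01 ?ler01 ?lexx.
pose V z : R := infs (X ^~ z) 0.
have lbX z : has_lbound (range (X ^~ z)).
  by exists 0 => _ [n _ <-]; have /andP[] := X01 n z.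
have VE z : V z = inf (range (X ^~ z)).
  rewrite /V /infs /=; congr inf; apply/seteqP.
  by split=> _ [n _ <-]; exists n.
have V_le z n : V z <= X n z by rewrite VE; apply: ge_inf => //; exists n.
have V_ge z a : (forall n, a <= X n z) -> a <= V z.
  move=> aX; rewrite VE; apply: lb_le_inf; first by exists (X 0%N z); exists 0%N.
  by move=> _ [n _ <-].
have mB n (A : set T) : measurable A ->
    measurable [set z : T * T | A z.1 /\ z.2 <= k (q n) z.1].
  by move=> mA; exact: measurable_product_sublevel.
have mV : measurable_fun setT V.
  apply: measurable_fun_infs => [z _|n]; first exact: lbX.
  apply: measurable_fun_ifT => //.
  apply: (measurable_fun_bool true); rewrite setTI.
  have := mB n setT measurableT; congr measurable.
  by apply/seteqP; split=> z //= [].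
(* Negative first coordinates are sent to 0, so that [0, u] pulls back to exactly ]-oo, u]. *)
have mF : measurable_fun setT (fun z : T * T => Num.max 0 (z.1 : R)).
  by apply: measurable_maxr => //; exact: measurable_fst.
have mh : measurable_fun setT (fun z : T * T => (Num.max 0 (z.1 : R), V z)).
  exact/measurable_fun_pairP.
pose h : {mfun (T * T)%type >-> (R * R)%type} :=
  HB.pack (fun z : T * T => (Num.max 0 (z.1 : R), V z))
    (isMeasurableFun.Build _ _ _ _ _ mh).
exists (distribution m h) => u v; rewrite !in_itv /= => /andP[u0 u1] /andP[v0 v1].
pose L : set T := `]-oo, u]%classic.
have mL : measurable L by exact: measurable_itv.
have mS : measurable [set z : T * T | L z.1 /\ V z <= v].
  apply: measurableI; last exact: measurable_le_level.
  by rewrite -[X in measurable X]setTI; exact: measurable_fst.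
rewrite [LHS](_ : _ = m [set z | L z.1 /\ V z <= v]); last first.
  rewrite /distribution /pushforward; congr (m _); apply/seteqP.
  split=> z /=; rewrite /L /= !in_itv /= ge_max le_max lexx u0 /=.
    by move=> [-> /andP[_ ->]].
  move=> [-> ->]; split=> //; rewrite andbT; apply: V_ge => n.
  by have /andP[] := X01 n z.
have CE w : 0 <= w <= 1 -> clamped C u w = C u w.
  by move=> w01; rewrite /clamped !clamp_id ?u0.
have mBE n : m [set z : T * T | L z.1 /\ z.2 <= k (q n) z.1] = (C u (q n))%:E.
  by rewrite [LHS]product_sublevel// kint// CE.
have lip w1 w2 : 0 <= w1 -> w1 <= w2 -> w2 <= 1 -> C u w2 - C u w1 <= w2 - w1.
  move=> ? w12 ?; rewrite -CE; last by lra.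
  by rewrite -(CE w1); [exact: clamped_lip_v|lra].
apply/eqP; rewrite eq_le; apply/andP; split; last first.
  (* Lower bound: for a level q in ]v - e, v[, the event w <= k_q(u) forces V <= q. *)
  apply/lee_subgt0Pr => e e0; rewrite -EFinB.
  have [ve|ve] := ltP v e.
    apply: (le_trans _ (measure_ge0 _ _)); rewrite lee_fin.
    have := lip 0 v (lexx _) v0 v1.
    by rewrite (copula_u0 hC) ?in_itv /= ?u0//; lra.
  have [//|||n /andP[vn nv]] := @clamped_rat_dense R (v - e) v; [lra..|].
  apply: (@le_trans _ _ (C u (q n))%:E).
    rewrite lee_fin; have /andP[q0 q1] := q01 n.
    by have := lip (q n) v q0 (ltW nv) v1; rewrite /q; lra.
  rewrite -mBE; apply: le_measure; rewrite ?inE//; first exact: mB.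
  move=> z [Lz zk]; split=> //; apply: (le_trans (V_le z n)).
  by rewrite /X zk ltW.
(* No level lies above v = 1; there the event sits in a strip of measure u. *)
have [v_lt1|v_ge1] := ltP v 1; last first.
  have v_eq : v = 1 by lra.
  rewrite v_eq (copula_u1 hC) ?in_itv /= ?u0//.
  rewrite -U_cdf ?u0// -[leRHS]mule1 -(probability_setT U).
  rewrite -[leRHS](product_measure1E U U)//.
  apply: le_measure; rewrite ?inE//; last by move=> z [].
    by rewrite -v_eq.
  exact: measurableX.
apply/lee_addgt0Pr => e e0; rewrite -EFinD.
have [|||n /andP[vn]] := @clamped_rat_dense R v (Num.min 1 (v + e)).
- exact: v0.
- by rewrite lt_min v_lt1 ltrDl.
- by rewrite ge_min lexx.
rewrite lt_min -/(q n) in vn * => /andP[qn1 qne].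
(* The points where monotonicity fails between the levels q i and q n; there are countably many
   levels, so their union is null. *)
pose N i : set T := [set x | q i < q n /\ k (q n) x < k (q i) x].
have mN i : measurable (N i).
  rewrite /N; have [_|_] := ltP (q i) (q n); last first.
    by rewrite (_ : [set _ | _] = set0)//; apply/seteqP; split=> x // [].
  rewrite (_ : [set _ | _] = [set x | k (q n) x < k (q i) x]).
    by rewrite -[X in measurable X]setTI; exact: measurable_fun_ltr.
  by apply/seteqP; split=> x // [].
have N0 : U (\bigcup_i N i) = 0.
  apply/negligibleP; first exact: bigcup_measurable.
  apply: negligible_bigcup => i; apply/negligibleP => //.
  have [qi|qi] := ltP (q i) (q n); last first.
    rewrite (_ : N i = set0) ?measure0//; apply/seteqP; split=> x // [].
    by rewrite ltNge qi.
  rewrite -(kmono _ _ (ltW qi)); congr (U _).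
  by apply/seteqP; split=> x // [].
have mN0 : m ((\bigcup_i N i) `*` setT) = 0.
  rewrite [LHS](product_measure1E U U)//; last exact: bigcup_measurable.
  exact: etrans (congr1 (fun a => a * U setT)%E N0) (mul0e _).
apply: (@le_trans _ _ (C u (q n))%:E); last first.
  rewrite lee_fin; have /andP[q0 q1] := q01 n.
  by have := lip v (q n) v0 (ltW vn) q1; lra.
rewrite -mBE -[leRHS]adde0 -mN0.
have mNT : measurable ((\bigcup_i N i) `*` [set: T]).
  by apply: measurableX => //; exact: bigcup_measurable.
apply: le_trans (measureU2 _ (mB n _ mL) mNT).
apply: le_measure; rewrite ?inE//; first by apply: measurableU => //; exact: mB.
move=> z [Lz Vz].
(* As V <= v < q n < 1, some admissible level q i lies below q n; monotonicity carries it to q n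
   outside the null set. *)
have [i Xi] : exists i, X i z < q n.
  apply: contrapT => /forallNP Xq; have : q n <= V z.
    by apply: V_ge => i; rewrite leNgt; apply/negP; exact: Xq.
  by lra.
move: Xi; rewrite /X; case: ifP => zk qi; last by move: qi; rewrite ltNge ltW.
have [kk|kk] := leP (k (q i) z.1) (k (q n) z.1).
  by left; split=> //; exact: le_trans zk kk.
by right; split=> //; exists i.
Qed.

End copula_measure_existence.

(** * Gini's gamma as a mean, and its bounds in terms of C(1/2, 1/2) *)

Section gini_blomqvist.
Context {R : realType} (C : R -> R -> R) (hC : copula C).
Let P := copula_measure C.

Lemma copula_measureP : has_cdf C P.
Proof.
have := copula_has_cdf hC; rewrite /P /copula_measure.
by move=> [Q hQ]; exact: (xgetPex _ (ex_intro _ Q hQ)).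
Qed.

Let half01 : (1 / 2 : R) \in `[0, 1].
Proof. by rewrite in_itv /=; lra. Qed.

Let one01 : (1 : R) \in `[0, 1].
Proof. by rewrite in_itv /=; lra. Qed.

Lemma measurable_unit_square : measurable (@unit_square R).
Proof. by apply: measurableX; exact: measurable_itv. Qed.

Lemma copula_measure_unit_square : P (@unit_square R) = 1%E.
Proof. by rewrite copula_measureP ?one01// (copula_u1 hC). Qed.

Lemma copula_measure_setC_unit_square : P (~` @unit_square R) = 0.
Proof.
rewrite probability_setC; last exact: measurable_unit_square.
by rewrite copula_measure_unit_square subee.
Qed.

Lemma copula_measure_setI (A : set (R * R)) : measurable A ->
  P A = P (A `&` @unit_square R).
Proof.
have mD := measurable_unit_square; move=> mA.
have mAD : measurable (A `&` @unit_square R) by exact: measurableI.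
have mD' : measurable (~` @unit_square R) by exact: measurableC.
apply/eqP; rewrite eq_le; apply/andP; split; last first.
  by apply: le_measure; rewrite ?inE//; exact: subIsetl.
rewrite -[leRHS]adde0 -copula_measure_setC_unit_square.
apply: le_trans (measureU2 _ mAD mD').
apply: le_measure; rewrite ?inE//; first exact: measurableU.
by move=> z Az; case: (pselect (unit_square z)) => ?; [left|right].
Qed.

(** Clamped coordinates agree with the true ones on the square, which has full mass, and stay in
    [0, 1] everywhere. *)
Let X (z : R * R) : R := clamp z.1.
Let Y (z : R * R) : R := clamp z.2.

Lemma copula_measure_le u v : 0 <= u <= 1 -> 0 <= v <= 1 ->
  P [set z | X z <= u /\ Y z <= v] = (C u v)%:E.
Proof.
move=> u01 v01; rewrite copula_measure_setI; last first.
  apply: measurableI; apply: measurable_le_level; apply: measurable_clamp.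
    exact: measurable_fst.
  exact: measurable_snd.
have <- : P (`[0, u] `*` `[0, v]) = (C u v)%:E.
  by apply: copula_measureP; rewrite in_itv.
congr (P _).
apply/seteqP; split=> z; rewrite /unit_square /X /Y /= !in_itv /=.
  by move=> [[zu zv] [z1 z2]]; move: zu zv; rewrite !clamp_id// => -> ->;
    move: z1 z2 => /andP[-> _] /andP[-> _].
move=> [/andP[z10 z1u] /andP[z20 z2v]].
by rewrite !clamp_id; lra.
Qed.

Lemma uniform_fst : uniform_rv P X.
Proof.
split; first by apply: measurable_clamp; exact: measurable_fst.
  by move=> z; rewrite /X clamp_ge0 clamp_le1.
move=> t t01; rewrite (_ : t%:E = (C t 1)%:E); last by rewrite (copula_u1 hC) ?in_itv.
rewrite -copula_measure_le ?ler01 ?lexx//; congr (P _).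
by apply/seteqP; split=> z /=; [rewrite /Y clamp_le1|case].
Qed.

Lemma uniform_snd : uniform_rv P Y.
Proof.
split; first by apply: measurable_clamp; exact: measurable_snd.
  by move=> z; rewrite /Y clamp_ge0 clamp_le1.
move=> t t01; rewrite (_ : t%:E = (C 1 t)%:E); last by rewrite (copula_1v hC) ?in_itv.
rewrite -copula_measure_le ?ler01 ?lexx//; congr (P _).
by apply/seteqP; split=> z /=; [rewrite /X clamp_le1|case].
Qed.

(** The complement of the square is null, so both concordance integrals extend to the plane in
    clamped coordinates and add up. *)
Lemma gini_gammaE :
  gini_gamma C = 4 * (\int[P]_z gini_kernel (X z) (Y z)) - 2.
Proof.
have hD (F : R -> R -> R) : (forall x y, 0 <= x <= 1 -> 0 <= y <= 1 ->
      0 <= F x y <= 1) -> measurable_fun setT (fun z => F (X z) (Y z)) ->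
    has_mean P (fun z => F (X z) (Y z)) (\int[P]_(z in @unit_square R) F z.1 z.2).
  move=> F01 mF.
  have : has_mean P (fun z => F (X z) (Y z)) (\int[P]_z F (X z) (Y z)).
    apply: (@has_mean_bounded _ _ _ P _ 1) => // z.
    have /andP[F0 F1] : 0 <= F (X z) (Y z) <= 1.
      by apply: F01; rewrite ?clamp_ge0 ?clamp_le1.
    by rewrite ger0_norm.
  move=> [Fi _]; split=> //; rewrite /Rintegral; congr fine.
  have mD' : measurable (~` @unit_square R).
    by apply: measurableC; exact: measurable_unit_square.
  rewrite (negligible_integral mD' measurableT Fi copula_measure_setC_unit_square).
  rewrite setTD setCK; apply: eq_integral => z.
  rewrite inE /unit_square /= !in_itv /= => -[z1 z2].
  by rewrite /X /Y !clamp_id.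
have [mX X01 _] := uniform_fst; have [mY Y01 _] := uniform_snd.
have hM := hD (@upper_copula R); have hW := hD (@lower_copula R).
have {hM hW} := has_meanD (hM _ _) (hW _ _).
rewrite /gini_gamma /concordance -/P => /(_ _ _ _ _)/proj2 E.
rewrite /gini_kernel [X in 4 * X - 2]E; first by ring.
- move=> x y x01 y01; rewrite /upper_copula.
  by case: (leP x y).
- exact: measurable_minr.
- move=> x y x01 y01; rewrite /lower_copula.
  by case: (leP 0 (x + y - 1)) => ?; lra.
- by apply: measurable_maxr => //; do 2 ?apply: measurable_funD.
Qed.

Lemma gini_gamma_ge : 6 * C (1 / 2) (1 / 2) ^+ 2 - 1 <= gini_gamma C.
Proof.
have := gini_kernel_ge uniform_fst uniform_snd.
by rewrite copula_measure_le ?gini_gammaE /=; lra.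
Qed.

Lemma gini_gamma_le :
  gini_gamma C <= 1 - 6 * (1 / 2 - C (1 / 2) (1 / 2)) ^+ 2.
Proof.
have := gini_kernel_le uniform_fst uniform_snd.
by rewrite copula_measure_le ?gini_gammaE /=; lra.
Qed.

(** The upper bound is the 2-increasing inequality on [0, 1/2] x [1/2, 1]. *)
Lemma copula_half_itv : 0 <= C (1 / 2) (1 / 2) <= 1 / 2.
Proof.
have := copula_range hC half01 half01; rewrite in_itv /= => /andP[-> _] /=.
have := copula_2increasing hC half01 half01 half01 one01.
have i0 : (0 : R) \in `[0, 1] by rewrite in_itv /=; lra.
have := copula_2increasing hC i0 half01 half01 one01.
rewrite (copula_u1 hC)// !(copula_0v hC)//; lra.
Qed.

End gini_blomqvist.

(** * From the quadratic inequalities to the bounds on beta *)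

Lemma le_sqrt_sqr (R : realType) (a b : R) : 0 <= a -> a ^+ 2 <= b -> a <= Num.sqrt b.
Proof. by move=> a0 ab; rewrite -{1}(ger0_norm a0) -sqrtr_sqr ler_wsqrtr. Qed.

Theorem corollary10 (R : realType) (C : R -> R -> R) (hC : copula C) :
  beta_lower (gini_gamma C) <= blomqvist_beta C <= beta_upper (gini_gamma C).
Proof.
have := gini_gamma_ge hC; have := gini_gamma_le hC; have := copula_half_itv hC.
rewrite /beta_lower /beta_upper /blomqvist_beta.
set g := gini_gamma C; set c := C _ _ => /andP[c0 c1] gle gge.
(* The constant bounds follow from 0 <= c <= 1/2; the others from (1 - 2c)^2 <= 2/3 (1 - g) and
   (2c)^2 <= 2/3 (1 + g). *)
apply/andP; split; case: ifP => _; try lra.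
  have : 1 - 2 * c <= Num.sqrt (2 / 3 * (1 - g)) by apply: le_sqrt_sqr; nra.
  lra.
have : 2 * c <= Num.sqrt (2 / 3 * (1 + g)) by apply: le_sqrt_sqr; nra.
lra.
Qed.
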